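(* (Objective Leibniz expansion.) Let $X$ be a finite groupoid with parity structure having $n$ orientable components, let $X\xleftarrow{s}A\xrightarrow{t}X$ be an endo-span in $\mathcal Z$ (a $\mathbb P$-span from $X$ to $X$), and let $\underline x=(x_1,\dots,x_n)$ be a tuple of orientable points, one for each orientable component of $X$. Then there is a canonical equivalence of scalars $$ {}_{\underline x}(\Lambda^nA)_{\underline x}\;\simeq\;\sum_{\sigma\in\Sigma_n}\mathrm{sign}(\sigma)\prod_{i=1}^n{}_{x_i}A_{x_{\sigma i}} . $$
   Context: Let $O(1)=\{+1,-1\}$ and let $\mathbb P=BO(1)$ be the one-object groupoid with automorphism group $O(1)$. All groupoids are finite (finitely many isomorphism classes, finite hom sets), and pullbacks, fibres and quotients are homotopy (weak) ones. A parity structure on a groupoid $S$ is a functor $S\to\mathbb P$; it assigns to each arrow $a$ a parity $\mathrm{par}(a)\in\{\pm1\}$ (even $=+1$, odd $=-1$), multiplicatively. $\mathcal Z$ is the $2$-category of finite groupoids with parity structure (the weak slice of finite groupoids over $\mathbb P$). $\mathsf e:1\to\mathbb P$ is the unique parity structure on the terminal groupoid. A point is orientable if it has no odd automorphism; a component is orientable if its points are. A $\mathbb P$-span from $f:S\to\mathbb P$ to $g:T\to\mathbb P$ is a span of groupoids $S\xleftarrow{p}M\xrightarrow{q}T$ with a natural isomorphism $\rho:f p\Rightarrow g q$, i.e. signs $\rho_x\in\{\pm1\}$ with $\mathrm{par}(p(a))\,\rho_{x'}=\rho_x\,\mathrm{par}(q(a))$ for each $a:x\to x'$ in $M$. A scalar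 is a $\mathbb P$-span from $\mathsf e$ to $\mathsf e$, i.e. a groupoid with a locally constant sign function; an equivalence of scalars is a sign-preserving equivalence of groupoids. The two-sided fibre ${}_iM_j$ of a $\mathbb P$-span $I\xleftarrow{p}M\xrightarrow{q}J$ is the scalar with objects $(m,a:i\to p(m),b:q(m)\to j)$ and sign $\mathrm{par}(a)\rho_m\mathrm{par}(b)$. Sums of scalars are disjoint unions; products are product groupoids with signs multiplied; $\mathrm{sign}(\sigma)\cdot S$ is $S$ if $\sigma$ is even and is $S$ with all signs reversed if $\sigma$ is odd. For a parity groupoid $X$, the exterior power $\Lambda^nX$ is the weak quotient groupoid $X^n/\Sigma_n$: objects are $n$-tuples in $X$; a morphism $(y_1,\dots,y_n)\to(x_1,\dots,x_n)$ consists of $\sigma\in\Sigma_n$ and arrows $\gamma_j:y_j\to x_{\sigma(j)}$ in $X$, and its parity is $\mathrm{sign}(\sigma)\,\mathrm{par}(\gamma_1)\cdots\mathrm{par}(\gamma_n)$. For a $\mathbb P$-span $S\leftarrow M\to T$ with $2$-cell $\epsilon$, its $n$th exterior power is the $\mathbb P$-span $\Lambda^nS\leftarrow\Lambda^nM\to\Lambda^nT$, where $\Lambda^nM=M^n/\Sigma_n$, the legs are induced componentwise, and the $2$-cell has component $\epsilon_{m_1}\cdots\epsilon_{m_n}$ at $(m_1,\dots,m_n)$. *)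

(* Defs.v *)
From mathcomp Require Import all_boot all_fingroup.
From mathcomp Require Import boolp.

Set Implicit Arguments.
Unset Strict Implicit.
Unset Printing Implicit Defensive.

(* [finite_upto R]: some finite family meets every element of [T] up to [R].
   For [R] an equivalence relation this says that [T / R] is finite; for
   [R] equality it says that [T] is finite. *)
Definition finite_upto (T : Type) (R : T -> T -> Prop) : Prop :=
  exists (K : finType) (f : K -> T), forall x, exists k, R x (f k).

(* Composition is written in diagrammatic order: [f ;; g] is "[f] then [g]". *)
Record groupoid : Type := Groupoid {
  ob :> Type;
  hom : ob -> ob -> Type;
  idh : forall x, hom x x;
  cmp : forall x y z, hom x y -> hom y z -> hom x z;
  inv : forall x y, hom x y -> hom y x;
  cmpA : forall x y z t (f : hom x y) (g : hom y z) (h : hom z t),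
    cmp f (cmp g h) = cmp (cmp f g) h;
  cmp1h : forall x y (f : hom x y), cmp (idh x) f = f;
  cmph1 : forall x y (f : hom x y), cmp f (idh y) = f;
  cmpVh : forall x y (f : hom x y), cmp (inv f) f = idh y;
  cmphV : forall x y (f : hom x y), cmp f (inv f) = idh x;
  iso_classes_finite : finite_upto (fun x y => inhabited (hom x y));
  hom_finite : forall x y, finite_upto (@eq (hom x y)) }.

Arguments hom {G} : rename.
Arguments idh {G} x : rename.
Arguments cmp {G x y z} : rename.
Arguments inv {G x y} : rename.

Notation "f ;; g" := (cmp f g) (at level 49, left associativity).

Record functor (G H : groupoid) : Type := Functor {
  fob :> G -> H;
  fmap : forall x y, hom x y -> hom (fob x) (fob y);
  fmap_id : forall x, fmap (idh x) = idh (fob x);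
  fmap_cmp : forall x y z (f : hom x y) (g : hom y z),
    fmap (f ;; g) = fmap f ;; fmap g }.

Arguments fmap {G H} F {x y} : rename.

Definition functor_id (G : groupoid) : functor G G :=
  @Functor G G id (fun _ _ f => f) (fun _ => erefl) (fun _ _ _ _ _ => erefl).

Lemma functor_comp_id (G H K : groupoid) (F : functor G H) (F' : functor H K) x :
  fmap F' (fmap F (idh x)) = idh (F' (F x)).
Proof. by rewrite !fmap_id. Qed.

Lemma functor_comp_cmp (G H K : groupoid) (F : functor G H) (F' : functor H K)
    (x y z : G) (f : hom x y) (g : hom y z) :
  fmap F' (fmap F (f ;; g)) = fmap F' (fmap F f) ;; fmap F' (fmap F g).
Proof. by rewrite !fmap_cmp. Qed.

(* First [F], then [F']. *)
Definition functor_comp (G H K : groupoid) (F : functor G H) (F' : functor H K) :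
    functor G K :=
  @Functor G K (fun x => F' (F x)) (fun _ _ f => fmap F' (fmap F f))
    (functor_comp_id F F') (@functor_comp_cmp _ _ _ F F').

(* Between groupoids every natural transformation is invertible. *)
Record nat_iso (G H : groupoid) (F F' : functor G H) : Type := NatIso {
  component :> forall x, hom (F x) (F' x);
  naturality : forall x y (a : hom x y),
    fmap F a ;; component y = component x ;; fmap F' a }.

Record equivalence (G H : groupoid) : Type := Equivalence {
  eqv_fun : functor G H;
  eqv_inv : functor H G;
  eqv_unit : nat_iso (functor_id G) (functor_comp eqv_fun eqv_inv);
  eqv_counit : nat_iso (functor_comp eqv_inv eqv_fun) (functor_id H) }.

Lemma finite_upto_fin (K : finType) : finite_upto (@eq K).
Proof. by exists K, id => x; exists x. Qed.

Lemma finite_upto_img (T U : Type) (R : T -> T -> Prop) (R' : U -> U -> Prop)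
    (g : T -> U) :
  finite_upto R -> (forall u, exists t, forall t', R t t' -> R' u (g t')) ->
  finite_upto R'.
Proof.
move=> [K [f fP]] gP; exists K, (g \o f) => u.
have [t tP] := gP u; have [k kP] := fP t; exists k; exact: tP.
Qed.

Lemma finite_upto_prod (I : finType) (T : I -> Type)
    (R : forall i, T i -> T i -> Prop) :
  (forall i, finite_upto (@R i)) ->
  finite_upto (fun x y : forall i, T i => forall i, R i (x i) (y i)).
Proof.
move=> h0.
have h i : {K : finType & {f : K -> T i | forall x, exists k, R i x (f k)}}.
  by have /cid[K /cid[f fP]] := h0 i; exists K, f.
pose K i := projT1 (h i).
pose f i : K i -> T i := sval (projT2 (h i)).
exists {dffun forall i, K i}, (fun (k : {dffun forall i, K i}) i => f i (k i)) => x.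
have kP i : exists k, R i (x i) (f i k) by exact: (svalP (projT2 (h i))).
exists (finfun (fun i => sval (cid (kP i)))) => i.
rewrite ffunE; exact: (svalP (cid (kP i))).
Qed.

Lemma finite_upto_sig (I : Type) (Q : I -> I -> Prop) (T : I -> Type)
    (R : forall i, T i -> T i -> Prop) (R' : {i & T i} -> {i & T i} -> Prop) :
  finite_upto Q -> (forall i, finite_upto (@R i)) ->
  (forall i j, Q i j -> forall x : T i, exists y : T j, forall y', R j y y' ->
     R' (existT _ i x) (existT _ j y')) ->
  finite_upto R'.
Proof.
move=> [L [l lP]] h0 hR.
have h i : {K : finType & {f : K -> T i | forall x, exists k, R i x (f k)}}.
  by have /cid[K /cid[f fP]] := h0 i; exists K, f.
pose K i := projT1 (h i).
pose f i : K i -> T i := sval (projT2 (h i)).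
exists {i : L & K (l i)}, (fun u => existT _ (l (tag u)) (f _ (tagged u))) => -[i x].
have [k kP] := lP i; have [y yP] := hR _ _ kP x.
have [k' k'P] := svalP (projT2 (h (l k))) y.
by exists (existT _ k k'); apply: yP.
Qed.

Lemma inhabited_prod (I : Type) (T : I -> Type) :
  (forall i, inhabited (T i)) -> inhabited (forall i, T i).
Proof.
move=> h; constructor => i.
have /cid[t _] : exists t : T i, True by case: (h i) => t; exists t.
exact: t.
Qed.

Lemma finite_upto_pair (T U : Type) :
  finite_upto (@eq T) -> finite_upto (@eq U) -> finite_upto (@eq (T * U)).
Proof.
move=> [K [f fP]] [L [g gP]]; exists (K * L)%type, (fun k => (f k.1, g k.2)).
by move=> [x y]; have [k ->] := fP x; have [l ->] := gP y; exists (k, l).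
Qed.

Lemma finite_upto_sub (T : Type) (P : T -> Prop) :
  finite_upto (@eq T) -> finite_upto (@eq {x | P x}).
Proof.
move=> [K [f fP]].
exists {k : K | `[< P (f k) >]}.
exists (fun k => exist P (f (sval k)) (asboolW (svalP k))) => -[x px].
have [k xE] := fP x; rewrite xE in px *.
exists (exist _ k (asboolT px)); congr exist; exact: Prop_irrelevance.
Qed.

Lemma BO1_iso_finite : finite_upto (fun _ _ : unit => inhabited bool).
Proof. by exists unit, id => x; exists x; constructor; exact: false. Qed.

(* $O(1)$ is encoded as [bool] under exclusive or: [b] stands for $(-1)^b$, so
   [true] is odd ($-1$) and [false] is even ($+1$), as for [odd_perm].
   Products of signs are hence [(+)] and [\big[addb/false]]. *)
Definition BO1 : groupoid :=
  @Groupoid unit (fun _ _ => bool) (fun _ => false) (fun _ _ _ => addb)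
    (fun _ _ b => b) (fun _ _ _ _ => addbA) (fun _ _ => addFb)
    (fun _ _ => addbF) (fun _ _ => addbb) (fun _ _ => addbb)
    BO1_iso_finite
    (fun _ _ => finite_upto_fin bool).

Record parity_groupoid : Type := ParityGroupoid {
  gpd :> groupoid;
  parity : functor gpd BO1 }.

Definition par (X : parity_groupoid) (x y : X) (a : hom x y) : bool :=
  fmap (parity X) a.

Definition orientable (X : parity_groupoid) (x : X) : Prop :=
  forall a : hom x x, par a = false.

Definition connected (G : groupoid) (x y : G) : Prop := inhabited (hom x y).

(* [x] picks one point in each orientable component of [X]: all [x i] are
   orientable, and the component of each orientable point contains exactly one
   of them. So [X] has exactly [n] orientable components. *)
Definition orientable_representatives (X : parity_groupoid) (n : nat)
    (x : 'I_n -> X) : Prop :=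
  (forall i, orientable (x i)) /\
  (forall y : X, orientable y -> exists! i, connected y (x i)).

Record Pspan (S T : parity_groupoid) : Type := PSpan {
  apex : groupoid;
  lleg : functor apex S;
  rleg : functor apex T;
  cell : nat_iso (functor_comp lleg (parity S)) (functor_comp rleg (parity T)) }.

Definition rho (S T : parity_groupoid) (M : Pspan S T) (m : apex M) : bool :=
  cell M m.

Lemma par_id (X : parity_groupoid) (x : X) : par (idh x) = false.
Proof. exact: (fmap_id (parity X) x). Qed.

Lemma par_cmp (X : parity_groupoid) (x y z : X) (a : hom x y) (b : hom y z) :
  par (a ;; b) = par a (+) par b.
Proof. exact: (fmap_cmp (parity X) a b). Qed.

Lemma rhoP (S T : parity_groupoid) (M : Pspan S T) (m m' : apex M)
    (a : hom m m') :
  par (fmap (lleg M) a) (+) rho m' = rho m (+) par (fmap (rleg M) a).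
Proof. exact: (naturality (cell M) a). Qed.

(* A $\mathbb P$-span from $\mathsf e$ to $\mathsf e$, that is, a groupoid with a
   locally constant sign; [true] is the sign $-1$. *)
Record scalar : Type := Scalar {
  sgpd :> groupoid;
  ssign : sgpd -> bool;
  ssignP : forall x y : sgpd, hom x y -> ssign x = ssign y }.

Arguments ssign {S} : rename.

Record scalar_equivalence (S S' : scalar) : Type := ScalarEquivalence {
  seqv :> equivalence S S';
  seqv_sign : forall x : S, ssign (eqv_fun seqv x) = ssign x }.

Lemma sign_mul_subproof (S : scalar) (b : bool) (x y : S) :
  hom x y -> b (+) ssign x = b (+) ssign y.
Proof. by move=> a; rewrite (ssignP a). Qed.

Definition sign_mul (n : nat) (s : 'S_n) (S : scalar) : scalar :=
  @Scalar S (fun x => odd_perm s (+) ssign x) (@sign_mul_subproof S (odd_perm s)).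

Section Sum.
Variables (I : finType) (G : I -> groupoid).

Definition sum_hom (u v : {i & G i}) : Type :=
  {e : tag u = tag v & hom (eq_rect (tag u) G (tagged u) (tag v) e) (tagged v)}.

Definition sum_id (u : {i & G i}) : sum_hom u u :=
  existT _ erefl (idh (tagged u)).

Definition sum_cmp (u v w : {i & G i}) :
  sum_hom u v -> sum_hom v w -> sum_hom u w.
Proof.
case: u v w => [i x] [j y] [k z] [/= e f] [/= e' g].
by destruct e'; destruct e; exists erefl; exact: (f ;; g).
Defined.

Definition sum_inv (u v : {i & G i}) : sum_hom u v -> sum_hom v u.
Proof.
case: u v => [i x] [j y] [/= e f].
by destruct e; exists erefl; exact: (inv f).
Defined.

Lemma sum_cmpA u v w t (f : sum_hom u v) (g : sum_hom v w) (h : sum_hom w t) :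
  sum_cmp f (sum_cmp g h) = sum_cmp (sum_cmp f g) h.
Proof.
case: u v w t f g h => [i x] [j y] [k z] [l t] [/= e f] [/= e' g] [/= e'' h].
by destruct e'', e', e; rewrite /= cmpA.
Qed.

Lemma sum_cmp1h u v (f : sum_hom u v) : sum_cmp (sum_id u) f = f.
Proof.
by case: u v f => [i x] [j y] [/= e f]; destruct e; rewrite /= cmp1h.
Qed.

Lemma sum_cmph1 u v (f : sum_hom u v) : sum_cmp f (sum_id v) = f.
Proof.
by case: u v f => [i x] [j y] [/= e f]; destruct e; rewrite /= cmph1.
Qed.

Lemma sum_cmpVh u v (f : sum_hom u v) : sum_cmp (sum_inv f) f = sum_id v.
Proof.
by case: u v f => [i x] [j y] [/= e f]; destruct e; rewrite /= cmpVh.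
Qed.

Lemma sum_cmphV u v (f : sum_hom u v) : sum_cmp f (sum_inv f) = sum_id u.
Proof.
by case: u v f => [i x] [j y] [/= e f]; destruct e; rewrite /= cmphV.
Qed.

Lemma sum_iso_finite : finite_upto (fun u v => inhabited (sum_hom u v)).
Proof.
apply: (@finite_upto_sig I eq _ (fun i x y => inhabited (hom x y))).
- exact: finite_upto_fin.
- by move=> i; apply: iso_classes_finite.
- move=> i j E; case: j / E => x; exists x => y [f].
  by constructor; exists erefl.
Qed.

Lemma sum_hom_finite u v : finite_upto (@eq (sum_hom u v)).
Proof.
apply: (@finite_upto_sig _ (fun _ _ => True) _ (fun e => @eq _)).
- have [e|ne] := pselect (tag u = tag v).
    by exists unit, (fun=> e) => ?; exists tt.
  by exists void, (fun v : void => match v with end) => e; case: ne.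
- by move=> e; apply: hom_finite.
- move=> e e' _ f; rewrite (eq_irrelevance e' e).
  by exists f => _ <-.
Qed.

Definition sum_groupoid : groupoid :=
  Groupoid sum_cmpA sum_cmp1h sum_cmph1 sum_cmpVh sum_cmphV
    sum_iso_finite sum_hom_finite.
End Sum.

Lemma sum_ssignP (I : finType) (S : I -> scalar) (u v : sum_groupoid S) :
  hom u v -> ssign (tagged u) = ssign (tagged v).
Proof.
by case: u v => [i x] [j y] [/= e f]; destruct e; exact: ssignP f.
Qed.

Definition sum_scalar (I : finType) (S : I -> scalar) : scalar :=
  @Scalar (sum_groupoid S) (fun u => ssign (tagged u)) (@sum_ssignP I S).

Section Prod.
Variables (I : finType) (G : I -> groupoid).

Definition prod_hom (x y : forall i, G i) : Type := forall i, hom (x i) (y i).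

Definition prod_id (x : forall i, G i) : prod_hom x x := fun i => idh (x i).

Definition prod_cmp x y z (f : prod_hom x y) (g : prod_hom y z) : prod_hom x z :=
  fun i => f i ;; g i.

Definition prod_inv x y (f : prod_hom x y) : prod_hom y x := fun i => inv (f i).

Lemma prod_cmpA x y z t (f : prod_hom x y) (g : prod_hom y z) (h : prod_hom z t) :
  prod_cmp f (prod_cmp g h) = prod_cmp (prod_cmp f g) h.
Proof. by apply: functional_extensionality_dep => i; apply: cmpA. Qed.

Lemma prod_cmp1h x y (f : prod_hom x y) : prod_cmp (prod_id x) f = f.
Proof. by apply: functional_extensionality_dep => i; apply: cmp1h. Qed.

Lemma prod_cmph1 x y (f : prod_hom x y) : prod_cmp f (prod_id y) = f.
Proof. by apply: functional_extensionality_dep => i; apply: cmph1. Qed.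

Lemma prod_cmpVh x y (f : prod_hom x y) : prod_cmp (prod_inv f) f = prod_id y.
Proof. by apply: functional_extensionality_dep => i; apply: cmpVh. Qed.

Lemma prod_cmphV x y (f : prod_hom x y) : prod_cmp f (prod_inv f) = prod_id x.
Proof. by apply: functional_extensionality_dep => i; apply: cmphV. Qed.

Lemma prod_iso_finite : finite_upto (fun x y => inhabited (prod_hom x y)).
Proof.
apply: (finite_upto_img (g := id)).
  exact: (finite_upto_prod (fun i => @iso_classes_finite (G i))).
by move=> x; exists x => y /inhabited_prod.
Qed.

Lemma prod_hom_finite x y : finite_upto (@eq (prod_hom x y)).
Proof.
apply: (finite_upto_img (g := id)).
  exact: (finite_upto_prod (fun i => @hom_finite (G i) (x i) (y i))).
by move=> f; exists f => g fg; apply: functional_extensionality_dep.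
Qed.

Definition prod_groupoid : groupoid :=
  Groupoid prod_cmpA prod_cmp1h prod_cmph1 prod_cmpVh prod_cmphV
    prod_iso_finite prod_hom_finite.
End Prod.

Lemma prod_ssignP (I : finType) (S : I -> scalar) (x y : prod_groupoid S) :
  hom x y ->
  \big[addb/false]_(i : I) ssign (x i) = \big[addb/false]_(i : I) ssign (y i).
Proof. by move=> f; apply: eq_bigr => i _; apply: ssignP (f i). Qed.

Definition prod_scalar (I : finType) (S : I -> scalar) : scalar :=
  @Scalar (prod_groupoid S) (fun x => \big[addb/false]_(i : I) ssign (x i))
    (@prod_ssignP I S).

(* The identity arrow of [x j], with target rewritten along [j = k]. *)
Definition reindex_arrow (I : Type) (G : groupoid) (x : I -> G) (j k : I)
    (e : j = k) : hom (x j) (x k) :=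
  match e with erefl => idh (x j) end.

Lemma reindex_nat (I J : Type) (G : groupoid) (y : I -> G) (x : J -> G)
    (s : I -> J) (f : forall j, hom (y j) (x (s j))) j k (e : j = k) (e' : s j = s k) :
  reindex_arrow y e ;; f k = f j ;; reindex_arrow x e'.
Proof.
by case: k / e e' => e'; rewrite (Prop_irrelevance e' erefl) /= cmp1h cmph1.
Qed.

Lemma reindex_irr (I : Type) (G : groupoid) (x : I -> G) (j k : I)
    (e e' : j = k) :
  reindex_arrow x e = reindex_arrow x e'.
Proof. by rewrite (Prop_irrelevance e e'). Qed.

Lemma reindex_cmp (I : Type) (G : groupoid) (x : I -> G) (j k l : I)
    (e : j = k) (e' : k = l) :
  reindex_arrow x e ;; reindex_arrow x e' = reindex_arrow x (etrans e e').
Proof. by case: l / e'; rewrite cmph1. Qed.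

Lemma reindex_id (I : Type) (G : groupoid) (x : I -> G) (j : I) (e : j = j) :
  reindex_arrow x e = idh (x j).
Proof. by rewrite (Prop_irrelevance e erefl). Qed.

Lemma fmap_reindex (I : Type) (G H : groupoid) (F : functor G H) (x : I -> G)
    (j k : I) (e : j = k) :
  fmap F (reindex_arrow x e) = reindex_arrow (fun i => F (x i)) e.
Proof. by case: k / e; rewrite /= fmap_id. Qed.

Lemma par_reindex (I : Type) (X : parity_groupoid) (x : I -> X) (j k : I)
    (e : j = k) :
  par (reindex_arrow x e) = false.
Proof. by case: k / e; rewrite par_id. Qed.

Section Pow.
Variables (n : nat) (G : groupoid).
Implicit Types x y z t : 'I_n -> G.

Definition pow_hom y x : Type := {s : 'S_n & forall j, hom (y j) (x (s j))}.

(* [permM : (s * t) j = t (s j)], so in diagrammatic order the underlying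
   permutation of a composite is the product of the permutations. *)
Definition pow_cmp y x z (f : pow_hom y x) (g : pow_hom x z) : pow_hom y z :=
  existT _ (tag f * tag g)%g
    (fun j => tagged f j ;; tagged g (tag f j)
                ;; reindex_arrow z (esym (permM (tag f) (tag g) j))).

Definition pow_id x : pow_hom x x :=
  existT _ 1%g (fun j => reindex_arrow x (esym (perm1 j))).

Definition pow_inv y x (f : pow_hom y x) : pow_hom x y :=
  existT _ (tag f)^-1%g
    (fun j => reindex_arrow x (esym (permKV (tag f) j))
                ;; inv (tagged f ((tag f)^-1%g j))).

Lemma pow_hom_eq y x (f g : pow_hom y x) (e : forall j, tag f j = tag g j) :
  (forall j, tagged f j ;; reindex_arrow x (e j) = tagged g j) -> f = g.
Proof.
case: f g e => [s f] [t g] /= e h.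
have E : s = t by apply/permP.
case: t / E g e h => g e h; congr existT.
apply: functional_extensionality_dep => j.
by rewrite -h reindex_id cmph1.
Qed.

Lemma pow_cmpA x y z t (f : pow_hom x y) (g : pow_hom y z) (h : pow_hom z t) :
  pow_cmp f (pow_cmp g h) = pow_cmp (pow_cmp f g) h.
Proof.
have e j : tag (pow_cmp f (pow_cmp g h)) j = tag (pow_cmp (pow_cmp f g) h) j.
  by rewrite /= mulgA.
apply: (pow_hom_eq (e := e)) => j /=.
rewrite -!cmpA; congr (_ ;; (_ ;; _)).
have e1 : tag h (tag g (tag f j)) = tag h ((tag f * tag g)%g j) by rewrite permM.
rewrite [RHS]cmpA (reindex_nat (tagged h) _ e1) -!cmpA; congr (_ ;; _).
by rewrite !reindex_cmp; apply: reindex_irr.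
Qed.

Lemma pow_cmp1h x y (f : pow_hom x y) : pow_cmp (pow_id x) f = f.
Proof.
have e j : tag (pow_cmp (pow_id x) f) j = tag f j by rewrite /= mul1g.
apply: (pow_hom_eq (e := e)) => j /=.
have e1 : tag f j = tag f ((1%g : 'S_n) j) by rewrite perm1.
rewrite (reindex_nat (tagged f) _ e1) -!cmpA !reindex_cmp.
exact: (etrans (congr1 _ (reindex_id _ _)) (cmph1 _)).
Qed.

Lemma pow_cmph1 x y (f : pow_hom x y) : pow_cmp f (pow_id y) = f.
Proof.
have e j : tag (pow_cmp f (pow_id y)) j = tag f j by rewrite /= mulg1.
apply: (pow_hom_eq (e := e)) => j /=; rewrite -!cmpA !reindex_cmp.
exact: (etrans (congr1 _ (reindex_id _ _)) (cmph1 _)).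
Qed.

Lemma pow_cmpVh x y (f : pow_hom x y) : pow_cmp (pow_inv f) f = pow_id y.
Proof.
have e j : tag (pow_cmp (pow_inv f) f) j = tag (pow_id y) j by rewrite /= mulVg.
apply: (pow_hom_eq (e := e)) => j /=.
rewrite -!cmpA (cmpA (inv _)) cmpVh cmp1h !reindex_cmp.
exact: reindex_irr.
Qed.

Lemma pow_cmphV x y (f : pow_hom x y) : pow_cmp f (pow_inv f) = pow_id x.
Proof.
have e j : tag (pow_cmp f (pow_inv f)) j = tag (pow_id x) j by rewrite /= mulgV.
apply: (pow_hom_eq (e := e)) => j /=.
have e1 : j = (tag f)^-1%g (tag f j) by rewrite permK.
rewrite -!cmpA reindex_cmp (reindex_irr y _ (congr1 (tag f) e1)) cmpA.
rewrite -(reindex_nat (tagged f) e1) -cmpA (cmpA (tagged f _)) cmphV cmp1h.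
by rewrite reindex_cmp; apply: reindex_irr.
Qed.

(* The arrow of $G^n/\Sigma_n$ with identity permutation and components [f]. *)
Definition tuple_arrow y x (f : forall j, hom (y j) (x j)) : pow_hom y x :=
  existT _ 1%g (fun j => f j ;; reindex_arrow x (esym (perm1 j))).

Lemma pow_iso_finite : finite_upto (fun y x => inhabited (pow_hom y x)).
Proof.
apply: (finite_upto_img (g := id)).
  exact: (finite_upto_prod (fun _ : 'I_n => @iso_classes_finite G)).
move=> x; exists x => y /inhabited_prod[f].
by constructor; exact: tuple_arrow.
Qed.

Lemma pow_hom_finite y x : finite_upto (@eq (pow_hom y x)).
Proof.
apply: (@finite_upto_sig 'S_n eq _
  (fun s (f g : forall j, hom (y j) (x (s j))) => forall j, f j = g j)).
- exact: finite_upto_fin.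
- move=> s; exact: (finite_upto_prod (fun j => @hom_finite G (y j) (x (s j)))).
- move=> s s0 E; case: s0 / E => f; exists f => g fg.
  by congr existT; apply: functional_extensionality_dep.
Qed.

Definition pow_groupoid : groupoid :=
  Groupoid pow_cmpA pow_cmp1h pow_cmph1 pow_cmpVh pow_cmphV
    pow_iso_finite pow_hom_finite.
End Pow.

Section PowFunctor.
Variables (n : nat) (G H : groupoid) (F : functor G H).

Definition pow_fmap (y x : pow_groupoid n G) (f : hom y x) :
    @hom (pow_groupoid n H) (fun j => F (y j)) (fun j => F (x j)) :=
  existT _ (tag f) (fun j => fmap F (tagged f j)).

Lemma pow_fmap_id x : pow_fmap (idh x) = idh _.
Proof.
congr existT; apply: functional_extensionality_dep => j.
by rewrite fmap_reindex.
Qed.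

Lemma pow_fmap_cmp x y z (f : hom x y) (g : hom y z) :
  @pow_fmap x z (f ;; g) = pow_fmap f ;; pow_fmap g.
Proof.
congr existT; apply: functional_extensionality_dep => j /=.
by rewrite !fmap_cmp fmap_reindex.
Qed.

Definition pow_functor : functor (pow_groupoid n G) (pow_groupoid n H) :=
  @Functor (pow_groupoid n G) (pow_groupoid n H) (fun x j => F (x j))
    pow_fmap pow_fmap_id pow_fmap_cmp.
End PowFunctor.

Section Exterior.
Variables (n : nat) (X : parity_groupoid).

Definition ext_par (y x : pow_groupoid n X) (f : hom y x) : bool :=
  odd_perm (tag f) (+) \big[addb/false]_(j < n) par (tagged f j).

Lemma ext_par_id x : ext_par (idh x) = false.
Proof.
rewrite /ext_par /= odd_perm1 big1 // => j _; exact: par_reindex.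
Qed.

Lemma ext_par_cmp x y z (f : hom x y) (g : hom y z) :
  @ext_par x z (f ;; g) = ext_par f (+) ext_par g.
Proof.
rewrite /ext_par /= odd_permM.
rewrite (eq_bigr (fun j => par (tagged f j) (+) par (tagged g (tag f j)))); last first.
  by move=> j _; rewrite !par_cmp par_reindex addbF.
rewrite big_split /= -(reindex_inj (perm_inj (s := tag f)) (P := xpredT)
  (F := fun j => par (tagged g j))).
by rewrite addbACA.
Qed.

Definition exterior_power : parity_groupoid :=
  @ParityGroupoid (pow_groupoid n X)
    (@Functor (pow_groupoid n X) BO1 (fun _ => tt) ext_par ext_par_id ext_par_cmp).
End Exterior.

Section ExteriorSpan.
Variables (n : nat) (S T : parity_groupoid) (M : Pspan S T).

Definition ext_rho (m : pow_groupoid n (apex M)) : bool :=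
  \big[addb/false]_(j < n) rho (m j).

Lemma ext_rhoP (m m' : pow_groupoid n (apex M)) (a : hom m m') :
  @ext_par n S _ _ (fmap (pow_functor n (lleg M)) a) (+) ext_rho m' =
  ext_rho m (+) @ext_par n T _ _ (fmap (pow_functor n (rleg M)) a).
Proof.
rewrite /ext_par /ext_rho /= addbCA -addbA; congr (_ (+) _).
rewrite (reindex_inj (perm_inj (s := tag a)) (P := xpredT) (F := fun j => rho (m' j))).
rewrite -!big_split /=; apply: eq_bigr => j _; exact: rhoP.
Qed.

Definition exterior_span : Pspan (exterior_power n S) (exterior_power n T) :=
  @PSpan (exterior_power n S) (exterior_power n T) (pow_groupoid n (apex M))
    (pow_functor n (lleg M)) (pow_functor n (rleg M))
    (@NatIso (pow_groupoid n (apex M)) BO1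
      (functor_comp (pow_functor n (lleg M)) (parity (exterior_power n S)))
      (functor_comp (pow_functor n (rleg M)) (parity (exterior_power n T)))
      ext_rho ext_rhoP).
End ExteriorSpan.

Lemma fmap_invK (G H : groupoid) (F : functor G H) (x y : G) (f : hom x y) :
  fmap F f ;; fmap F (inv f) = idh (F x) /\ fmap F (inv f) ;; fmap F f = idh (F y).
Proof. by rewrite -!fmap_cmp cmpVh cmphV !fmap_id. Qed.

Section Fibre.
Variables (S T : parity_groupoid) (M : Pspan S T) (i : S) (j : T).

Record fibre_ob : Type := FibreOb {
  fib_pt : apex M;
  fib_in : hom i (lleg M fib_pt);
  fib_out : hom (rleg M fib_pt) j }.

Definition fibre_hom (u v : fibre_ob) : Type :=
  {f : hom (fib_pt u) (fib_pt v) |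
     fib_in u ;; fmap (lleg M) f = fib_in v /\
     fmap (rleg M) f ;; fib_out v = fib_out u}.

Lemma fibre_hom_eq u v (f g : fibre_hom u v) : sval f = sval g -> f = g.
Proof.
case: f g => [f pf] [g pg] /= E; case: g / E pg => pg.
by congr exist; apply: Prop_irrelevance.
Qed.

Lemma fibre_id_subproof (u : fibre_ob) :
  fib_in u ;; fmap (lleg M) (idh (fib_pt u)) = fib_in u /\
  fmap (rleg M) (idh (fib_pt u)) ;; fib_out u = fib_out u.
Proof. by rewrite !fmap_id cmp1h cmph1. Qed.

Definition fibre_id (u : fibre_ob) : fibre_hom u u :=
  exist _ (idh (fib_pt u)) (fibre_id_subproof u).

Lemma fibre_cmp_subproof u v w (f : fibre_hom u v) (g : fibre_hom v w) :
  fib_in u ;; fmap (lleg M) (sval f ;; sval g) = fib_in w /\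
  fmap (rleg M) (sval f ;; sval g) ;; fib_out w = fib_out u.
Proof.
case: f g => [f [f1 f2]] [g [g1 g2]] /=; rewrite !fmap_cmp.
by rewrite cmpA f1 g1 -cmpA g2 f2.
Qed.

Definition fibre_cmp u v w (f : fibre_hom u v) (g : fibre_hom v w) :
    fibre_hom u w :=
  exist _ (sval f ;; sval g) (fibre_cmp_subproof f g).

Lemma fibre_inv_subproof u v (f : fibre_hom u v) :
  fib_in v ;; fmap (lleg M) (inv (sval f)) = fib_in u /\
  fmap (rleg M) (inv (sval f)) ;; fib_out u = fib_out v.
Proof.
case: f => [f [f1 f2]] /=; rewrite -f1 -f2 -cmpA.
have [-> _] := fmap_invK (lleg M) f; rewrite cmph1; split=> //.
by rewrite cmpA; have [_ ->] := fmap_invK (rleg M) f; rewrite cmp1h.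
Qed.

Definition fibre_inv u v (f : fibre_hom u v) : fibre_hom v u :=
  exist _ (inv (sval f)) (fibre_inv_subproof f).

Lemma fibre_cmpA u v w t (f : fibre_hom u v) (g : fibre_hom v w) (h : fibre_hom w t) :
  fibre_cmp f (fibre_cmp g h) = fibre_cmp (fibre_cmp f g) h.
Proof. by apply: fibre_hom_eq; apply: cmpA. Qed.

Lemma fibre_cmp1h u v (f : fibre_hom u v) : fibre_cmp (fibre_id u) f = f.
Proof. by apply: fibre_hom_eq; apply: cmp1h. Qed.

Lemma fibre_cmph1 u v (f : fibre_hom u v) : fibre_cmp f (fibre_id v) = f.
Proof. by apply: fibre_hom_eq; apply: cmph1. Qed.

Lemma fibre_cmpVh u v (f : fibre_hom u v) : fibre_cmp (fibre_inv f) f = fibre_id v.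
Proof. by apply: fibre_hom_eq; apply: cmpVh. Qed.

Lemma fibre_cmphV u v (f : fibre_hom u v) : fibre_cmp f (fibre_inv f) = fibre_id u.
Proof. by apply: fibre_hom_eq; apply: cmphV. Qed.

Lemma fibre_iso_finite : finite_upto (fun u v => inhabited (fibre_hom u v)).
Proof.
pose T' m : Type := (hom i (lleg M m) * hom (rleg M m) j)%type.
apply: (@finite_upto_img {m & T' m} _
  (fun u v => inhabited (fibre_hom (FibreOb (tagged u).1 (tagged u).2)
                                   (FibreOb (tagged v).1 (tagged v).2))) _
  (fun u => FibreOb (tagged u).1 (tagged u).2)); last first.
  by case=> m a b; exists (existT T' m (a, b)).
apply: (@finite_upto_sig (apex M) _ T' (fun _ => eq)).
- exact: iso_classes_finite.
- by move=> m; apply: finite_upto_pair; apply: hom_finite.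
- move=> m m' [f] [a b].
  exists (a ;; fmap (lleg M) f, fmap (rleg M) (inv f) ;; b) => _ <-.
  constructor; exists f => /=; split => //.
  by rewrite cmpA; have [-> _] := fmap_invK (rleg M) f; rewrite cmp1h.
Qed.

Lemma fibre_hom_finite u v : finite_upto (@eq (fibre_hom u v)).
Proof. exact: finite_upto_sub (@hom_finite _ _ _). Qed.

Definition fibre_groupoid : groupoid :=
  Groupoid fibre_cmpA fibre_cmp1h fibre_cmph1 fibre_cmpVh fibre_cmphV
    fibre_iso_finite fibre_hom_finite.

Definition fibre_sign (u : fibre_ob) : bool :=
  par (fib_in u) (+) rho (fib_pt u) (+) par (fib_out u).

Lemma fibre_signP (u v : fibre_groupoid) : hom u v -> fibre_sign u = fibre_sign v.
Proof.
case: u v => [m a b] [m' a' b'] [/= f [/= fa fb]]; rewrite /fibre_sign /= -fa -fb.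
by rewrite !par_cmp !addbA -(addbA (par a)) -rhoP addbA.
Qed.

Definition fibre : scalar := @Scalar fibre_groupoid fibre_sign fibre_signP.
End Fibre.

Arguments fibre {S T} M i j.

Lemma tuple_arrow_cmp (n : nat) (G : groupoid) (x y z : 'I_n -> G)
    (f : forall j, hom (x j) (y j)) (g : pow_hom y z) :
  pow_cmp (tuple_arrow f) g = existT _ (tag g) (fun j => f j ;; tagged g j).
Proof.
pose h : pow_hom x z := existT _ (tag g) (fun j => f j ;; tagged g j).
have e j : tag (pow_cmp (tuple_arrow f) g) j = tag h j by rewrite /= mul1g.
apply: (pow_hom_eq (g := h) (e := e)) => j /=.
have e1 : tag g j = tag g ((1%g : 'S_n) j) by rewrite perm1.
rewrite -!cmpA; congr (_ ;; _).
rewrite !cmpA (reindex_nat (tagged g) _ e1) -!cmpA !reindex_cmp.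
exact: (etrans (congr1 _ (reindex_id _ _)) (cmph1 _)).
Qed.

Lemma tuple_arrow_cmp2 (n : nat) (G : groupoid) (x y z : 'I_n -> G)
    (f : forall j, hom (x j) (y j)) (g : forall j, hom (y j) (z j)) :
  pow_cmp (tuple_arrow f) (tuple_arrow g) = tuple_arrow (fun j => f j ;; g j).
Proof.
rewrite tuple_arrow_cmp; congr existT; apply: functional_extensionality_dep => j.
exact: cmpA.
Qed.

Lemma tuple_arrow_id (n : nat) (G : groupoid) (x : 'I_n -> G) :
  tuple_arrow (fun j => idh (x j)) = pow_id x.
Proof. by congr existT; apply: functional_extensionality_dep => j; apply: cmp1h. Qed.

Lemma pow_fmap_tuple (n : nat) (G H : groupoid) (F : functor G H)
    (x y : 'I_n -> G) (f : forall j, hom (x j) (y j)) :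
  pow_fmap F (tuple_arrow f) = tuple_arrow (fun j => fmap F (f j)).
Proof.
congr existT; apply: functional_extensionality_dep => j /=.
by rewrite fmap_cmp fmap_reindex.
Qed.

Section Leibniz.
Variables (n : nat) (X : parity_groupoid) (A : Pspan X X) (x : 'I_n -> X).

Definition leibniz_lhs : scalar :=
  @fibre (exterior_power n X) (exterior_power n X) (exterior_span n A) x x.

Definition leibniz_rhs : scalar :=
  sum_scalar (fun s : 'S_n =>
    sign_mul s (prod_scalar (fun i : 'I_n => fibre A (x i) (x (s i))))).

Definition leibniz_ob (u : leibniz_rhs) : leibniz_lhs :=
  @FibreOb (exterior_power n X) (exterior_power n X) (exterior_span n A) x x
    (fun i => fib_pt (tagged u i))
    (tuple_arrow (fun i => fib_in (tagged u i)))
    (existT _ (tag u) (fun i => fib_out (tagged u i))).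

Lemma leibniz_fmap_subproof (s : 'S_n)
    (w w' : prod_groupoid (fun i => fibre A (x i) (x (s i)))) (f : hom w w') :
  fib_in (leibniz_ob (existT _ s w))
    ;; fmap (lleg (exterior_span n A)) (tuple_arrow (fun i => sval (f i)))
  = fib_in (leibniz_ob (existT _ s w')) /\
  fmap (rleg (exterior_span n A)) (tuple_arrow (fun i => sval (f i)))
    ;; fib_out (leibniz_ob (existT _ s w'))
  = fib_out (leibniz_ob (existT _ s w)).
Proof.
rewrite /= !pow_fmap_tuple tuple_arrow_cmp2 tuple_arrow_cmp; split.
  congr tuple_arrow; apply: functional_extensionality_dep => i.
  by have [] := svalP (f i).
congr existT; apply: functional_extensionality_dep => i.
by have [] := svalP (f i).
Qed.

Definition leibniz_fmap (u v : leibniz_rhs) :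
  hom u v -> hom (leibniz_ob u) (leibniz_ob v).
Proof.
case: u v => [s w] [t w'] [/= e]; destruct e => f.
exact: (exist _ (tuple_arrow (fun i => sval (f i))) (leibniz_fmap_subproof f)).
Defined.

Lemma leibniz_fmap_id (u : leibniz_rhs) :
  leibniz_fmap (idh u) = idh (leibniz_ob u).
Proof. by case: u => s w; apply: fibre_hom_eq; apply: tuple_arrow_id. Qed.

Lemma leibniz_fmap_cmp (u v w : leibniz_rhs) (f : hom u v) (g : hom v w) :
  leibniz_fmap (f ;; g) = leibniz_fmap f ;; leibniz_fmap g.
Proof.
case: u v w f g => [s u] [t v] [r w] [/= e f] [/= e' g].
by destruct e', e; apply: fibre_hom_eq; rewrite /= tuple_arrow_cmp2.
Qed.

(* The canonical comparison: in the summand of $\sigma$, the family of the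
   $(m_i,\ a_i : x_i \to s(m_i),\ b_i : t(m_i) \to x_{\sigma i})$ goes to
   $((m_i)_i,\ (\mathrm{id}, (a_i)_i),\ (\sigma, (b_i)_i))$. *)
Definition leibniz_functor : functor leibniz_rhs leibniz_lhs :=
  Functor leibniz_fmap_id leibniz_fmap_cmp.
End Leibniz.

(* Main.v *)
Require Import Defs.
From mathcomp Require Import all_boot all_fingroup.
From mathcomp Require Import boolp.

(** The canonical comparison functor from the sum to the fibre preserves signs,
    is fully faithful and essentially surjective, hence is one half of an
    equivalence.  A morphism between two objects in its image must have trivial
    permutation, because the left structure maps do; compatibility with the
    right structure maps then forces both objects into the same summand.  An
    object with left permutation [s] and right permutation [t] is isomorphic,
    through [s], to the image of an object of the summand of [s * t]. *)

Set Implicit Arguments.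
Unset Strict Implicit.
Unset Printing Implicit Defensive.

Definition fully_faithful (H G : groupoid) (F : functor H G) : Prop :=
  forall (u v : H) (f : hom (F u) (F v)), exists! h : hom u v, fmap F h = f.

Definition essentially_surjective (H G : groupoid) (F : functor H G) : Prop :=
  forall y : G, exists u : H, inhabited (hom (F u) y).

(** The quasi-inverse chooses [g y] with an arrow [e y : F (g y) -> y] and lifts conjugates by [e]
    through [F]; its laws hold because they hold after applying [F], which is injective on arrows.
    [F] is the [eqv_inv] half, since the equivalence starts from its target. *)
Lemma equivalence_of_fully_faithful (H G : groupoid) (F : functor H G) :
  fully_faithful F -> essentially_surjective F ->
  exists E : equivalence G H, eqv_inv E = F.
Proof.
move=> ff es.
have /choice[g gP] := es.
have eP y : {e : hom (F (g y)) y | True}.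
  by apply: cid; case: (gP y) => e; exists e.
pose e y : hom (F (g y)) y := sval (eP y).
have liftP u v (f : hom (F u) (F v)) : {h : hom u v | fmap F h = f}.
  by apply: cid; have [h [hE _]] := ff u v f; exists h.
pose lift u v f : hom u v := sval (liftP u v f).
have liftE u v f : fmap F (lift u v f) = f by exact: svalP (liftP u v f).
have inj u v (h h' : hom u v) : fmap F h = fmap F h' -> h = h'.
  have [k [_ kP]] := ff u v (fmap F h').
  by move=> hh'; rewrite -(kP h hh') -(kP h').
pose gmap x y (a : hom x y) := lift _ _ (e x ;; a ;; Defs.inv (e y)).
have gmap_id x : gmap x x (idh x) = idh (g x).
  by apply: inj; rewrite liftE fmap_id cmph1 cmphV.
have gmap_cmp x y z (a : hom x y) (b : hom y z) :
    gmap x z (a ;; b) = gmap x y a ;; gmap y z b.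
  apply: inj; rewrite fmap_cmp !liftE !cmpA.
  by rewrite -(cmpA _ (Defs.inv (e y)) (e y)) cmpVh cmph1.
pose K := @Functor G H g gmap gmap_id gmap_cmp.
have unit : nat_iso (functor_id G) (functor_comp K F).
  exists (fun y => Defs.inv (e y)) => y z a.
  by rewrite /= liftE !cmpA cmpVh cmp1h.
have counit : nat_iso (functor_comp F K) (functor_id H).
  exists (fun u => lift _ _ (e (F u))) => u v a.
  apply: inj; rewrite !fmap_cmp !liftE.
  by rewrite -(cmpA _ (Defs.inv (e (F v)))) cmpVh cmph1.
by exists (Equivalence unit counit).
Qed.

(* Signs are locally constant, so the unit transports sign preservation from
   [F] to its quasi-inverse. *)
Lemma scalar_equivalence_of_fully_faithful (S' S : scalar) (F : functor S' S) :
  (forall u, ssign (F u) = ssign u) ->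
  fully_faithful F -> essentially_surjective F ->
  exists E : scalar_equivalence S S', eqv_inv E = F.
Proof.
move=> Fsign ff es; have [E EF] := equivalence_of_fully_faithful ff es.
have Esign y : ssign (eqv_fun E y) = ssign y.
  by rewrite -Fsign -EF (ssignP (eqv_unit E y)).
by exists (ScalarEquivalence Esign).
Qed.

Lemma existT_inj (T : Type) (P : T -> Type) (t : T) (a b : P t) :
  existT P t a = existT P t b -> a = b.
Proof.
move=> ab; have := projT2_eq ab.
by rewrite (Prop_irrelevance (projT1_eq ab) erefl).
Qed.

Lemma reindex_arrowK (I : Type) (G : groupoid) (x : I -> G) (z : G) (j k : I)
    (e : j = k) (f : hom z (x k)) :
  f ;; reindex_arrow x (esym e) ;; reindex_arrow x e = f.
Proof. by case: k / e f => f; rewrite /= !cmph1. Qed.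

(** Each component is stored followed by a transport along [perm1], which composing with the reverse
    transport undoes. *)
Lemma tuple_arrow_inj (n : nat) (G : groupoid) (x y : 'I_n -> G)
    (f g : forall j, hom (x j) (y j)) :
  tuple_arrow f = tuple_arrow g -> f = g.
Proof.
move=> tfg; have fg := existT_inj tfg; apply: functional_extensionality_dep => j.
have := congr1 (fun h => h j ;; reindex_arrow y (perm1 j)) fg.
by rewrite !reindex_arrowK.
Qed.

Lemma tag1_tuple_arrow (n : nat) (G : groupoid) (x y : 'I_n -> G)
    (f : pow_hom x y) :
  tag f = 1%g -> exists g, f = tuple_arrow g.
Proof.
move=> f1; have e j : tag f j = j by rewrite f1 perm1.
pose g j := tagged f j ;; reindex_arrow y (e j); exists g.
have e1 j : tag f j = (1%g : 'S_n) j by rewrite f1.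
apply: (pow_hom_eq (g := tuple_arrow g) (e := e1)) => j /=.
by rewrite -cmpA reindex_cmp; congr (_ ;; _); apply: reindex_irr.
Qed.

Section LeibnizFunctor.
Variables (n : nat) (X : parity_groupoid) (A : Pspan X X) (x : 'I_n -> X).

Lemma ext_par_tuple_arrow (y z : 'I_n -> X) (f : forall j, hom (y j) (z j)) :
  @ext_par n X y z (tuple_arrow f) = \big[addb/false]_(j < n) par (f j).
Proof.
rewrite /ext_par /= odd_perm1; apply: eq_bigr => j _.
by rewrite par_cmp par_reindex addbF.
Qed.

(** Only the right structure map carries a nontrivial permutation, so its parity alone contributes
    the sign of [s]. *)
Lemma leibniz_sign (u : leibniz_rhs A x) :
  ssign (leibniz_functor A x u) = ssign u.
Proof.
case: u => s w.
transitivity (@ext_par n X _ _ (tuple_arrow (fun i => fib_in (w i)))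
  (+) (\big[addb/false]_(i < n) rho (fib_pt (w i)))
  (+) (odd_perm s (+) \big[addb/false]_(i < n) par (fib_out (w i)))) => //.
by rewrite ext_par_tuple_arrow addbCA -!big_split.
Qed.

Lemma leibniz_full (u v : leibniz_rhs A x)
    (f : hom (leibniz_functor A x u) (leibniz_functor A x v)) :
  exists h : hom u v, fmap (leibniz_functor A x) h = f.
Proof.
suff [h hE] : exists h : hom u v, sval (fmap (leibniz_functor A x) h) = sval f.
  by exists h; apply: fibre_hom_eq.
case: u v f => [s w] [t w'] [/= f [fl fr]].
have f1 : tag f = 1%g.
  by have := congr1 (@tag _ _) fl; rewrite tuple_arrow_cmp.
have [g Eg] := tag1_tuple_arrow f1; subst f.
move: fl fr; rewrite !pow_fmap_tuple tuple_arrow_cmp2 tuple_arrow_cmp /=.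
move=> /tuple_arrow_inj gl gr.
have ts : s = t := esym (congr1 (@tag _ _) gr).
(* [w'] and [g] have types depending on [t], so they are generalised before [t] is replaced by
   [s]. *)
case: t / ts w' g {f1} gl gr => w' g gl tgr.
have gr := existT_inj tgr.
have gP i : fib_in (w i) ;; fmap (lleg A) (g i) = fib_in (w' i) /\
            fmap (rleg A) (g i) ;; fib_out (w' i) = fib_out (w i).
  by split; [have := congr1 (fun h => h i) gl | have := congr1 (fun h => h i) gr].
by exists (existT _ erefl (fun i => exist _ (g i) (gP i))).
Qed.

Lemma leibniz_faithful (u v : leibniz_rhs A x) (h h' : hom u v) :
  fmap (leibniz_functor A x) h = fmap (leibniz_functor A x) h' -> h = h'.
Proof.
case: u v h h' => [s w] [t w'] [/= e f] [/= e' f'].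
(* Equality proofs between permutations are unique, so [h] and [h'] lie over the same index
   equality. *)
destruct e; rewrite (eq_irrelevance e' erefl) in f' *.
move=> /(congr1 sval) /= /tuple_arrow_inj ff'.
congr existT; apply: functional_extensionality_dep => i.
by apply: fibre_hom_eq; have := congr1 (fun h => h i) ff'.
Qed.

Lemma leibniz_essentially_surjective :
  essentially_surjective (leibniz_functor A x).
Proof.
case=> /= m [s a] [t b] /=.
(* Since [a i] lands in the image of [m (s i)], position [i] takes the point [m (s i)] and the
   outgoing arrow [b (s i)], which ends at [x (t (s i))]. *)
pose w i : fibre A (x i) (x ((s * t)%g i)) :=
  FibreOb (a i) (b (s i) ;; reindex_arrow x (esym (permM s t i))).
exists (existT _ (s * t)%g w); constructor.
(* Pure relabelling by [s], with identity components: it turns left permutation [1] into [s], and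
   precomposing [t] with it gives [s * t]. *)
pose f : pow_hom (fun i => m (s i)) m := existT _ s (fun i => idh (m (s i))).
exists f => /=; split.
  rewrite tuple_arrow_cmp; congr existT; apply: functional_extensionality_dep => j.
  by rewrite /= fmap_id cmph1.
congr existT; apply: functional_extensionality_dep => j.
by rewrite /= fmap_id cmp1h.
Qed.

End LeibnizFunctor.

(** Canonicity is expressed by prescribing the quasi-inverse as the explicit [leibniz_functor]. *)
Theorem proposition4p3p6 (X : parity_groupoid) (n : nat) (A : Pspan X X)
  (x : 'I_n -> X) (hx : orientable_representatives x) :
  exists E : scalar_equivalence
      (fibre (exterior_span n A) x x)
      (sum_scalar (fun s : 'S_n =>
         sign_mul s (prod_scalar (fun i : 'I_n => fibre A (x i) (x (s i)))))),
    eqv_inv E = leibniz_functor A x.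
Proof.
apply: scalar_equivalence_of_fully_faithful.
- exact: leibniz_sign.
- move=> u v f; have [h hf] := leibniz_full f.
  by exists h; split=> // h' h'f; apply: leibniz_faithful; rewrite hf h'f.
- exact: leibniz_essentially_surjective.
Qed.
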